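(* Let $K$ be a field of characteristic different from $2$ and $3$. Every Akivis superalgebra $M$ over $K$ is special; that is, there exist a superalgebra $W$ over $K$ and an injective Akivis homomorphism $M\to W^A$.
   Context: A superalgebra is a (not necessarily associative) $\mathbb{Z}_2$-graded algebra over $K$. Akivis superalgebra: a supervector space $M=M_0\oplus M_1$ with (i) a bilinear map $[\,,\,]$ making $M$ a superalgebra ($[M_\alpha,M_\beta]\subseteq M_{\alpha+\beta}$) that is superanticommutative ($[x,y]=-(-1)^{\alpha\beta}[y,x]$ for $x\in M_\alpha,y\in M_\beta$), and (ii) a trilinear map $A:M\times M\times M\to M$ with $A(M_\alpha,M_\beta,M_\gamma)\subseteq M_{\alpha+\beta+\gamma}$, such that for all $x\in M_\alpha,y\in M_\beta,z\in M_\gamma$, $$[[x,y],z]+(-1)^{\alpha(\beta+\gamma)}[[y,z],x]+(-1)^{\gamma(\alpha+\beta)}[[z,x],y]=A(x,y,z)+(-1)^{\alpha(\beta+\gamma)}A(y,z,x)+(-1)^{\gamma(\alpha+\beta)}A(z,x,y)-(-1)^{\alpha\beta}A(y,x,z)-(-1)^{\alpha(\beta+\gamma)+\beta\gamma}A(z,y,x)-(-1)^{\beta\gamma}A(x,z,y).$$ For a superalgebra $W$, $W^A$ denotes the Akivis superalgebra on the supervector space $W$ with $[x,y]=xy-(-1)^{\alpha\beta}yx$ for $x\in W_\alpha,y\in W_\beta$ (extended bilinearly) and $A(x,y,z)=(xy)z-x(yz)$. An Akivis homomorphism between Akivis superalgebras $(M,[\,,\,],A)$ and $(N,[\,,\,]',A')$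 is a linear map $f:M\to N$ of degree $0$ (i.e. $f(M_\alpha)\subseteq N_\alpha$) with $f([x,y])=[f(x),f(y)]'$ and $f(A(x,y,z))=A'(f(x),f(y),f(z))$ for all $x,y,z\in M$. *)

(* Defs.v *)
From HB Require Import structures.
From mathcomp Require Import all_boot all_order all_algebra.

Set Implicit Arguments.
Unset Strict Implicit.
Unset Printing Implicit Defensive.

Import GRing.Theory.
Local Open Scope ring_scope.

(* Degrees in Z_2 are booleans: [false] is 0, [true] is 1, [(+)] is addition
   and [&&] is multiplication, so that (-1)^(alpha beta) is [(-1) ^+ (a && b)]. *)

(* A vector space of arbitrary dimension that is the internal direct sum of its
   subspaces [hpart false] and [hpart true].  The direct sum makes the two
   subspaces the fixed-point sets of the projections, so requiring boolean
   membership loses no generality. *)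
Record superVectType (K : fieldType) := SuperVect {
  sv_sort :> lmodType K;
  hpart : bool -> {pred sv_sort};
  hpart_submod : forall a, submod_closed (hpart a);
  hpart_sum : forall x, exists x0 x1,
    [/\ x0 \in hpart false, x1 \in hpart true & x = x0 + x1];
  hpart_cap : forall x, x \in hpart false -> x \in hpart true -> x = 0
}.
Arguments hpart {K} V a : rename.

Record superAlgType (K : fieldType) := SuperAlg {
  sa_sort :> superVectType K;
  smul : {bilinear sa_sort -> sa_sort -> sa_sort};
  smul_hpart : forall a b x y, x \in hpart sa_sort a -> y \in hpart sa_sort b ->
    smul x y \in hpart sa_sort (a (+) b)
}.
Arguments smul {K} W : rename.

Definition trilinear (K : fieldType) (V : lmodType K) (A : V -> V -> V -> V) :=
  [/\ forall y z, linear (fun x => A x y z),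
      forall x z, linear (fun y => A x y z)
    & forall x y, linear (fun z => A x y z)].

Record akivisSuperAlgType (K : fieldType) := AkivisSuperAlg {
  ak_sort :> superVectType K;
  abrk : {bilinear ak_sort -> ak_sort -> ak_sort};
  abrk_hpart : forall a b x y,
    x \in hpart ak_sort a -> y \in hpart ak_sort b ->
    abrk x y \in hpart ak_sort (a (+) b);
  abrk_anti : forall a b x y,
    x \in hpart ak_sort a -> y \in hpart ak_sort b ->
    abrk x y = - ((-1) ^+ (a && b) *: abrk y x);
  atri : ak_sort -> ak_sort -> ak_sort -> ak_sort;
  atri_trilinear : trilinear atri;
  atri_hpart : forall a b c x y z,
    x \in hpart ak_sort a -> y \in hpart ak_sort b -> z \in hpart ak_sort c ->
    atri x y z \in hpart ak_sort (a (+) b (+) c);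
  akivis_identity : forall a b c x y z,
    x \in hpart ak_sort a -> y \in hpart ak_sort b -> z \in hpart ak_sort c ->
    abrk (abrk x y) z
      + (-1) ^+ (a && (b (+) c)) *: abrk (abrk y z) x
      + (-1) ^+ (c && (a (+) b)) *: abrk (abrk z x) y
    = atri x y z
      + (-1) ^+ (a && (b (+) c)) *: atri y z x
      + (-1) ^+ (c && (a (+) b)) *: atri z x y
      - (-1) ^+ (a && b) *: atri y x z
      - (-1) ^+ ((a && (b (+) c)) (+) (b && c)) *: atri z y x
      - (-1) ^+ (b && c) *: atri x z y
}.
Arguments abrk {K} M : rename.
Arguments atri {K} M x y z : rename.

Definition akivis_hom (K : fieldType) (M N : akivisSuperAlgType K)
    (f : {linear M -> N}) : Prop :=
  [/\ forall a x, x \in hpart M a -> f x \in hpart N a,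
      forall x y, f (abrk M x y) = abrk N (f x) (f y)
    & forall x y z, f (atri M x y z) = atri N (f x) (f y) (f z)].

Section HomogeneousComponents.
Variables (K : fieldType) (V : superVectType K).

Lemma hpart0 a : 0 \in hpart V a.
Proof. by case: (hpart_submod V a). Qed.

Lemma hpartP a k x y :
  x \in hpart V a -> y \in hpart V a -> k *: x + y \in hpart V a.
Proof. by case: (hpart_submod V a) => _; apply. Qed.

Lemma hpartZ a k x : x \in hpart V a -> k *: x \in hpart V a.
Proof. by move=> hx; rewrite -[_ *: _]addr0 hpartP ?hpart0. Qed.

Lemma hpartB a x y : x \in hpart V a -> y \in hpart V a -> x - y \in hpart V a.
Proof. by move=> hx hy; rewrite addrC -scaleN1r hpartP. Qed.

Fact even_part_exists (x : V) :
  exists x0, (x0 \in hpart V false) && (x - x0 \in hpart V true).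
Proof.
have [x0 [x1 [h0 h1 ->]]] := hpart_sum x.
by exists x0; rewrite h0 addrC addKr.
Qed.

Definition hcomp (a : bool) (x : V) : V :=
  let x0 := xchoose (even_part_exists x) in if a then x - x0 else x0.

Lemma hcomp_in a x : hcomp a x \in hpart V a.
Proof. by have /andP[] := xchooseP (even_part_exists x); case: a. Qed.

Lemma hcompD x : hcomp false x + hcomp true x = x.
Proof. exact: subrKC. Qed.

Lemma hcomp_uniq x0 x1 : x0 \in hpart V false -> x1 \in hpart V true ->
  forall a, hcomp a (x0 + x1) = if a then x1 else x0.
Proof.
move=> h0 h1; set x := x0 + x1.
have e0 : hcomp false x = x0.
  apply/eqP; rewrite -subr_eq0; apply/eqP/hpart_cap.
    by rewrite hpartB ?hcomp_in.
  suff -> : hcomp false x - x0 = x1 - hcomp true x by rewrite hpartB ?hcomp_in.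
  apply/eqP; rewrite subr_eq addrAC -[_ + x0]addrC -/x eq_sym subr_eq.
  by rewrite hcompD.
case=> //; apply: (addrI x0).
by rewrite -{1}e0 hcompD.
Qed.

Lemma hcomp_hpart a b x : x \in hpart V a -> hcomp b x = if a == b then x else 0.
Proof.
case: a => hx.
  by rewrite -{1}[x]add0r hcomp_uniq ?hpart0 //; case: b.
by rewrite -{1}[x]addr0 hcomp_uniq ?hpart0 //; case: b.
Qed.

Fact hcomp_is_linear a : linear (hcomp a).
Proof.
move=> k x y.
rewrite -{1}[x]hcompD -{1}[y]hcompD scalerDr addrACA hcomp_uniq ?hpartP ?hcomp_in //.
by case: a.
Qed.

HB.instance Definition _ a :=
  GRing.isLinear.Build K V V _ (hcomp a) (hcomp_is_linear a).

End HomogeneousComponents.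

Section AkivisOfSuperAlg.
Variables (K : fieldType) (W : superAlgType K).
Local Notation mul := (smul W).

(* The bilinear extension of xy - (-1)^(alpha beta) yx from homogeneous
   elements to all of W. *)
Definition superbracket (x y : W) : W :=
  \sum_(a : bool) \sum_(b : bool)
    (mul (hcomp a x) (hcomp b y)
     - (-1) ^+ (a && b) *: mul (hcomp b y) (hcomp a x)).

Definition associator (x y z : W) : W := mul (mul x y) z - mul x (mul y z).

Lemma superbracketE a b x y : x \in hpart W a -> y \in hpart W b ->
  superbracket x y = mul x y - (-1) ^+ (a && b) *: mul y x.
Proof.
move=> hx hy; rewrite /superbracket !big_bool.
rewrite !(hcomp_hpart _ hx) !(hcomp_hpart _ hy).
by case: a b {hx hy} => -[] /=;
  rewrite ?(linear0l, linear0r, scaler0, oppr0, addr0, add0r).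
Qed.

Fact superbracket_is_bilinear :
  bilinear_for (GRing.Scale.Law.clone _ _ *:%R _)
    (GRing.Scale.Law.clone _ _ *:%R _) superbracket.
Proof.
split=> [y|x] k u v; rewrite /superbracket /= scaler_sumr -big_split /=;
  apply: eq_bigr => a _; rewrite scaler_sumr -big_split /=;
  apply: eq_bigr => b _.
- rewrite linearP linearPl linearPr scalerDr scalerBr opprD addrACA !scalerA.
  by rewrite mulrC.
- rewrite linearP linearPl linearPr scalerDr scalerBr opprD addrACA !scalerA.
  by rewrite mulrC.
Qed.

HB.instance Definition _ :=
  bilinear_isBilinear.Build K W W W _ _ superbracket superbracket_is_bilinear.

Fact superbracket_hpart a b x y : x \in hpart W a -> y \in hpart W b ->
  superbracket x y \in hpart W (a (+) b).
Proof.
move=> hx hy; rewrite (superbracketE hx hy).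
by rewrite hpartB ?(smul_hpart hx hy) ?hpartZ // addbC smul_hpart.
Qed.

Fact superbracket_anti a b x y : x \in hpart W a -> y \in hpart W b ->
  superbracket x y = - ((-1) ^+ (a && b) *: superbracket y x).
Proof.
move=> hx hy; rewrite (superbracketE hx hy) (superbracketE hy hx).
by rewrite scalerBr opprB scalerA [b && a]andbC -signr_addb addbb scale1r.
Qed.

Fact associator_trilinear : trilinear associator.
Proof.
split=> [y z|x z|x y] k u v; rewrite /associator.
- by rewrite !(linearPl, linearPr) scalerBr opprD addrACA.
- by rewrite !(linearPl, linearPr) scalerBr opprD addrACA.
- by rewrite !(linearPl, linearPr) scalerBr opprD addrACA.
Qed.

Fact associator_hpart a b c x y z :
  x \in hpart W a -> y \in hpart W b -> z \in hpart W c ->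
  associator x y z \in hpart W (a (+) b (+) c).
Proof.
move=> hx hy hz; rewrite hpartB //; first by rewrite !smul_hpart.
by rewrite -addbA !smul_hpart.
Qed.

Fact superbracket_akivis a b c x y z :
  x \in hpart W a -> y \in hpart W b -> z \in hpart W c ->
  superbracket (superbracket x y) z
    + (-1) ^+ (a && (b (+) c)) *: superbracket (superbracket y z) x
    + (-1) ^+ (c && (a (+) b)) *: superbracket (superbracket z x) y
  = associator x y z
    + (-1) ^+ (a && (b (+) c)) *: associator y z x
    + (-1) ^+ (c && (a (+) b)) *: associator z x y
    - (-1) ^+ (a && b) *: associator y x z
    - (-1) ^+ ((a && (b (+) c)) (+) (b && c)) *: associator z y x
    - (-1) ^+ (b && c) *: associator x z y.
Proof.
move=> hx hy hz.
rewrite (superbracketE (superbracket_hpart hx hy) hz).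
rewrite (superbracketE (superbracket_hpart hy hz) hx).
rewrite (superbracketE (superbracket_hpart hz hx) hy).
rewrite (superbracketE hx hy) (superbracketE hy hz) (superbracketE hz hx).
rewrite /associator !(linearBl, linearBr, linearZl_LR, linearZr_LR) /=.
rewrite !(scalerBr, opprB, opprD).
move: (mul (mul x y) z) (mul x (mul y z)) => ? ?.
move: (mul (mul y z) x) (mul y (mul z x)) => ? ?.
move: (mul (mul z x) y) (mul z (mul x y)) => ? ?.
move: (mul (mul y x) z) (mul y (mul x z)) => ? ?.
move: (mul (mul z y) x) (mul z (mul y x)) => ? ?.
move: (mul (mul x z) y) (mul x (mul z y)) => ? ?.
case: a b c {hx hy hz} => -[] [] /=;
  rewrite ?(expr0, expr1, scale1r, scaleN1r, opprK, opprD);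
  apply: (addIr 0); rewrite -!addrA;
  repeat match goal with |- ?t + _ = _ =>
    rewrite ?(addrCA _ t); congr (_ + _) end.
Qed.

Definition akivis_of : akivisSuperAlgType K :=
  @AkivisSuperAlg K W superbracket superbracket_hpart superbracket_anti
    associator associator_trilinear associator_hpart superbracket_akivis.

End AkivisOfSuperAlg.

Definition special (K : fieldType) (M : akivisSuperAlgType K) : Prop :=
  exists (W : superAlgType K) (f : {linear M -> akivis_of W}),
    akivis_hom f /\ injective f.

(* Main.v *)
Require Import Defs.
From mathcomp Require Import all_boot all_order all_algebra.
From HB Require Import structures.
From mathcomp Require Import boolp functions ring.

Set Implicit Arguments.
Unset Strict Implicit.
Unset Printing Implicit Defensive.

Import GRing.Theory.
Local Open Scope ring_scope.

(* An enveloping superalgebra need not contain more than [M] and its tensor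
   square: on [M] put [x y = [x, y]/2 + x o y], where [x o y] is the
   supersymmetrised tensor.  The only constraint on the products of tensors with
   elements of [M] is then
     [(x o y) z - x (y o z) = D(x, y, z)]
   with [D(x, y, z) = A(x, y, z) - ([x, y]/2) z + x ([y, z]/2)].  Let [s] and [t]
   be the signed transpositions of the first two and of the last two arguments.
   In the group algebra of S_3,
     [1 - Alt/6 = (1 + s)(1 - t)/3 + (1 + t)(3 - s + s t)/6],
   where [Alt] is the alternating sum.  The Akivis identity says exactly that
   [Alt] kills [D], so [D] is a map supersymmetric in its first two arguments
   minus one supersymmetric in its last two; these define the products.

   No grading of the tensors is needed: in the group algebra of Z_2 over the
   resulting algebra, a homogeneous [x] of degree [a] is sent to [x] times the
   group element [a]. *)

(** * Linear identities checked coefficient by coefficient *)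

Section LinearCombinations.
Variables (K : fieldType) (V : lmodType K).
Implicit Types (s : seq V) (x y : V) (c d : nat -> K).

(** The coefficients form a function of the index so that [c] can be left open and be filled in by
    the closure lemmas below, following the syntax of [x]. *)
Definition lincomb s x c := x = \sum_(i < size s) c i *: s`_i.

Lemma lincomb0 s : lincomb s 0 (fun=> 0).
Proof. by rewrite /lincomb big1 // => i _; rewrite scale0r. Qed.

Lemma lincombD s x y c d :
  lincomb s x c -> lincomb s y d -> lincomb s (x + y) (fun i => c i + d i).
Proof.
move=> -> ->; rewrite /lincomb -big_split.
by apply: eq_bigr => i _; rewrite scalerDl.
Qed.

Lemma lincombN s x c : lincomb s x c -> lincomb s (- x) (fun i => - c i).
Proof.
move=> ->; rewrite /lincomb -sumrN.
by apply: eq_bigr => i _; rewrite scaleNr.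
Qed.

Lemma lincombZ s x c k : lincomb s x c -> lincomb s (k *: x) (fun i => k * c i).
Proof.
move=> ->; rewrite /lincomb scaler_sumr.
by apply: eq_bigr => i _; rewrite scalerA.
Qed.

Lemma lincomb_nth s n : (n < size s)%N -> lincomb s s`_n (fun i => (i == n)%:R).
Proof.
move=> lt_n; rewrite /lincomb (bigD1 (Ordinal lt_n)) //= eqxx scale1r.
rewrite big1 ?addr0 // => i; rewrite -val_eqE /= => /negPf->.
by rewrite scale0r.
Qed.

Lemma eq_lincomb s x y c d : lincomb s x c -> lincomb s y d ->
  (forall i, (i < size s)%N -> c i = d i) -> x = y.
Proof. by move=> -> -> cd; apply: eq_bigr => i _; rewrite cd. Qed.

End LinearCombinations.

(* Reduces an equation between linear combinations of the vectors of [s] to the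
   equality of their coefficients; [s] may have at most nine vectors. *)
Ltac lincomb_tac s :=
  repeat lazymatch goal with
  | |- lincomb _ 0 _ => exact: lincomb0
  | |- lincomb _ (_ + _) _ => apply: lincombD
  | |- lincomb _ (- _) _ => apply: lincombN
  | |- lincomb _ (_ *: _) _ => apply: lincombZ
  | |- _ => first
    [ exact: (@lincomb_nth _ _ s 0) | exact: (@lincomb_nth _ _ s 1)
    | exact: (@lincomb_nth _ _ s 2) | exact: (@lincomb_nth _ _ s 3)
    | exact: (@lincomb_nth _ _ s 4) | exact: (@lincomb_nth _ _ s 5)
    | exact: (@lincomb_nth _ _ s 6) | exact: (@lincomb_nth _ _ s 7)
    | exact: (@lincomb_nth _ _ s 8) ]
  end.
Ltac by_coefficients s :=
  apply: (@eq_lincomb _ _ s);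
  [ lincomb_tac s | lincomb_tac s
  | do 9?[case=> [_|] /=]; last by [] ].

(** * Linear, bilinear and trilinear maps as bare functions *)

Lemma linear_fun0 (K : fieldType) (U V : lmodType K) (f : U -> V) :
  linear f -> f 0 = 0.
Proof. by move/(_ (-1) 0 0); rewrite scaler0 addr0 scaleN1r addNr. Qed.

Lemma linear_funZ (K : fieldType) (U V : lmodType K) (f : U -> V) k x :
  linear f -> f (k *: x) = k *: f x.
Proof. by move=> lf; rewrite -[k *: x]addr0 lf linear_fun0 ?addr0. Qed.

Definition bilin (K : fieldType) (U V : lmodType K) (f : U -> U -> V) :=
  (forall y, linear (f^~ y)) /\ (forall x, linear (f x)).

(** Unlike [trilinear], the target may differ from the source, as for maps from [M] to its extension
    by tensors. *)
Definition trilin (K : fieldType) (U V : lmodType K) (f : U -> U -> U -> V) :=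
  [/\ forall y z, linear (fun x => f x y z),
      forall x z, linear (fun y => f x y z)
    & forall x y, linear (fun z => f x y z)].

(** * The tensor square and its universal property *)

Section TensorSquare.
Variables (K : fieldType) (M : lmodType K).

(* [M (x) M], realised as linear functionals on the bilinear maps [M x M -> M];
   its universal property is only available for maps to [M] and, by evaluation
   at test maps, to [tensor] itself.  The values of a functional on maps that are
   not bilinear are irrelevant. *)
Definition tensor_pred : {pred (M -> M -> M) -> M} := fun p =>
  `[< forall k f g, bilin f -> bilin g ->
        p (fun x y => k *: f x y + g x y) = k *: p f + p g >].

Fact tensor_submod_closed : submod_closed tensor_pred.
Proof.
split=> [|k p q /asboolP lin_p /asboolP lin_q]; apply/asboolP => l f g bf bg.
  by rewrite scaler0 addr0.
rewrite !fctE lin_p // lin_q //.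
by by_coefficients [:: p f; p g; q f; q g]; ring.
Qed.
HB.instance Definition _ :=
  GRing.isSubmodClosed.Build K _ tensor_pred tensor_submod_closed.

Definition tensor := {p | tensor_pred p}.
HB.instance Definition _ := SubChoice.on tensor.
HB.instance Definition _ := [SubChoice_isSubLmodule of tensor by <:].

Lemma val_lin k (p q : tensor) f :
  val (k *: p + q) f = k *: val p f + val q f.
Proof. by rewrite linearP. Qed.

Lemma tensorP (p : tensor) k f g : bilin f -> bilin g ->
  val p (fun x y => k *: f x y + g x y) = k *: val p f + val p g.
Proof. by move=> bf bg; have /asboolP-> := valP p. Qed.

Lemma bilin_lin k (f g : M -> M -> M) : bilin f -> bilin g ->
  bilin (fun x y => k *: f x y + g x y).
Proof.
move=> [fl fr] [gl gr]; split=> z l x y.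
  rewrite fl gl.
  by by_coefficients [:: f x z; f y z; g x z; g y z]; ring.
rewrite fr gr.
by by_coefficients [:: f z x; f z y; g z x; g z y]; ring.
Qed.

(** Elements of [tensor] are equal only if they agree on all test maps. With the value 0 on maps
    that are not bilinear, [tens] is bilinear on the nose. *)
Fact tens_subproof x y : tensor_pred (fun f => if `[< bilin f >] then f x y else 0).
Proof.
apply/asboolP => k f g bf bg.
by rewrite !asboolT //; apply: bilin_lin.
Qed.
Definition tens x y : tensor := Sub _ (tens_subproof x y).

Lemma val_tens x y f : bilin f -> val (tens x y) f = f x y.
Proof. by move=> bf; rewrite SubK asboolT. Qed.

Lemma tens_bilin : bilin tens.
Proof.
by split=> z k x y; apply/val_inj/funext => f;
  rewrite linearP !fctE /=; case: asboolP => [[fl fr]|_];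
  rewrite ?scaler0 ?addr0 // (fl, fr).
Qed.

Notation W := (M * tensor)%type.

(** The tensor component of the lift, tested at [g]: evaluating the tensor component of [f] at [g]
    gives an [M]-valued bilinear map, to which [p] applies. *)
Definition lift_fun (f : M -> M -> W) (p : tensor) : (M -> M -> M) -> M :=
  fun g => val p (fun x y => val (f x y).2 g).

Lemma bilin_fst (f : M -> M -> W) : bilin f -> bilin (fun x y => (f x y).1).
Proof. by case=> fl fr; split=> z k x y; rewrite (fl, fr). Qed.

Lemma bilin_val (f : M -> M -> W) g :
  bilin f -> bilin (fun x y => val (f x y).2 g).
Proof. by case=> fl fr; split=> z k x y; rewrite (fl, fr) val_lin. Qed.

Lemma lift_subproof f p : bilin f -> tensor_pred (lift_fun f p).
Proof.
move=> bf; apply/asboolP => k g h bg bh; rewrite /lift_fun.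
rewrite -tensorP; try exact: bilin_val.
by congr (val p _); do 2!apply/funext => ?; rewrite tensorP.
Qed.

(* Junk value [0] in the second component when [f] is not bilinear. *)
Definition lift (f : M -> M -> W) (p : tensor) : W :=
  (val p (fun x y => (f x y).1), insubd 0 (lift_fun f p)).

Lemma val_lift f p : bilin f -> val (lift f p).2 = lift_fun f p.
Proof. by move=> bf; rewrite insubdK //; apply: lift_subproof. Qed.

Lemma lift_tens f x y : bilin f -> lift f (tens x y) = f x y.
Proof.
move=> bf; rewrite [RHS]surjective_pairing; congr pair.
  by rewrite val_tens //; apply: bilin_fst.
apply: val_inj; rewrite (val_lift _ bf); apply/funext => g.
by rewrite /lift_fun val_tens //; apply: bilin_val.
Qed.

Lemma lift_linear f : bilin f -> linear (lift f).
Proof.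
move=> bf k p q; congr pair.
apply/val_inj/funext => g.
by rewrite val_lin !val_lift // /lift_fun val_lin.
Qed.

(** Makes the products of [M] with tensors linear in the factor from [M], which enters only as a
    parameter of the lifted map. *)
Lemma lift_lin f g h k p : bilin f -> bilin g -> bilin h ->
  (forall x y, h x y = k *: f x y + g x y) ->
  lift h p = k *: lift f p + lift g p.
Proof.
move=> bf bg bh hE; congr pair.
  rewrite /= -tensorP; try exact: bilin_fst.
  by congr (val p _); do 2!apply/funext => ?; rewrite hE.
apply/val_inj/funext => r; rewrite val_lin !val_lift // /lift_fun.
rewrite -tensorP; try exact: bilin_val.
by congr (val p _); do 2!apply/funext => ?; rewrite hE val_lin.
Qed.

End TensorSquare.
Arguments tens {K M} x y.

(** * Closure properties of trilinear maps *)

Section Trilinear.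
Variables (K : fieldType) (U V : lmodType K).
Implicit Types f g : U -> U -> U -> V.

Lemma trilinD f g : trilin f -> trilin g -> trilin (fun x y z => f x y z + g x y z).
Proof.
move=> [f1 f2 f3] [g1 g2 g3]; split=> z t k x y;
  by rewrite (f1, f2, f3) (g1, g2, g3) scalerDr addrACA.
Qed.

Lemma trilinZ f k : trilin f -> trilin (fun x y z => k *: f x y z).
Proof.
move=> [f1 f2 f3]; split=> z t l x y;
  by rewrite (f1, f2, f3) scalerDr !scalerA mulrC.
Qed.

Lemma trilinN f : trilin f -> trilin (fun x y z => - f x y z).
Proof.
move=> [f1 f2 f3]; split=> z t l x y;
  by rewrite (f1, f2, f3) opprD scalerN.
Qed.

Lemma trilin_swap12 f : trilin f -> trilin (fun x y z => f y x z).
Proof. by case. Qed.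

Lemma trilin_swap23 f : trilin f -> trilin (fun x y z => f x z y).
Proof. by case. Qed.

Lemma trilin_rot f : trilin f -> trilin (fun x y z => f y z x).
Proof. by case. Qed.

Lemma trilin_sum (I : finType) (f : I -> U -> U -> U -> V) :
  (forall i, trilin (f i)) -> trilin (fun x y z => \sum_i f i x y z).
Proof.
move=> f_tri; split=> z t k x y; rewrite scaler_sumr -big_split;
  by apply: eq_bigr => i _; have [f1 f2 f3] := f_tri i; rewrite (f1, f2, f3).
Qed.

Lemma trilin_bilin12 f z : trilin f -> bilin (fun x y => f x y z).
Proof. by case. Qed.

Lemma trilin_bilin23 f x : trilin f -> bilin (f x).
Proof. by case. Qed.

End Trilinear.

(** * Signs depending on degrees *)

Section Twist.
Variables (K : fieldType) (M : superVectType K) (V : lmodType K).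

(** The trilinear extension of a signed map from homogeneous arguments, since [lift] needs maps
    defined on all of [M]. *)
Definition twist (s : bool -> bool -> bool -> bool) (f : M -> M -> M -> V) x y z :=
  \sum_(a : bool) \sum_(b : bool) \sum_(c : bool)
    (-1) ^+ s a b c *: f (hcomp a x) (hcomp b y) (hcomp c z).

Lemma trilin_twist s f : trilin f -> trilin (twist s f).
Proof.
move=> [f1 f2 f3]; do 3!apply: trilin_sum => ?; apply: trilinZ.
by split=> z t k x y; rewrite linearP (f1, f2, f3).
Qed.

Lemma twistE s f a b c x y z : trilin f ->
  x \in hpart M a -> y \in hpart M b -> z \in hpart M c ->
  twist s f x y z = (-1) ^+ s a b c *: f x y z.
Proof.
move=> [f1 f2 f3] hx hy hz; rewrite /twist !big_bool.
have f10 u v : f 0 u v = 0 := linear_fun0 (f1 u v).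
have f20 u v : f u 0 v = 0 := linear_fun0 (f2 u v).
have f30 u v : f u v 0 = 0 := linear_fun0 (f3 u v).
rewrite !(hcomp_hpart _ hx) !(hcomp_hpart _ hy) !(hcomp_hpart _ hz).
by case: a b c {hx hy hz} => -[] [] /=;
  rewrite ?(f10, f20, f30, scaler0, addr0, add0r).
Qed.

End Twist.

(** * Supersymmetrised tensors *)

Section SymmetricTensor.
Variables (K : fieldType) (M : superVectType K).

(** The double sum extends the signed flip of [tens x y] bilinearly from homogeneous arguments. *)
Definition symtens (x y : M) : tensor M :=
  2^-1 *: (tens x y + \sum_(a : bool) \sum_(b : bool)
             (-1) ^+ (a && b) *: tens (hcomp b y) (hcomp a x)).

Lemma bilin_symtens : bilin symtens.
Proof.
have [tl tr] := tens_bilin M.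
pose T x y := \sum_(a : bool) \sum_(b : bool)
  (-1) ^+ (a && b) *: tens (hcomp b y) (hcomp a x) : tensor M.
have [Tl Tr] : bilin T.
  split=> z k x y; rewrite /T scaler_sumr -big_split; apply: eq_bigr => a _;
    rewrite scaler_sumr -big_split; apply: eq_bigr => b _;
    by rewrite linearP (tl, tr) scalerDr !scalerA mulrC.
split=> z k x y; rewrite /symtens -!/(T _ _) (tl, tr) (Tl, Tr).
  by by_coefficients [:: tens x z; tens y z; T x z; T y z]; ring.
by by_coefficients [:: tens z x; tens z y; T z x; T z y]; ring.
Qed.

Lemma symtensE a b x y : x \in hpart M a -> y \in hpart M b ->
  symtens x y = 2^-1 *: (tens x y + (-1) ^+ (a && b) *: tens y x).
Proof.
have [tl tr] := tens_bilin M.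
have t0 u : tens u 0 = 0 :> tensor M := linear_fun0 (tr u).
have t0' u : tens 0 u = 0 :> tensor M := linear_fun0 (tl u).
move=> hx hy; rewrite /symtens !big_bool !(hcomp_hpart _ hx) !(hcomp_hpart _ hy).
by case: a b {hx hy} => -[] /=; rewrite ?(t0, t0', scaler0, addr0, add0r).
Qed.

Lemma symtensC a b x y : x \in hpart M a -> y \in hpart M b ->
  symtens y x = (-1) ^+ (a && b) *: symtens x y.
Proof.
move=> hx hy; rewrite (symtensE hx hy) (symtensE hy hx) andbC.
by case: (a && b); rewrite ?expr1 ?expr0; by_coefficients [:: tens x y; tens y x]; ring.
Qed.

End SymmetricTensor.

(** * The enveloping product on [M] plus its tensor square *)

Section Extension.
Variables (K : fieldType) (M : akivisSuperAlgType K).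
Notation W := (M * tensor M)%type.

Definition mulM (x y : M) : W := (2^-1 *: abrk M x y, symtens x y).

Lemma bilin_mulM : bilin mulM.
Proof.
have [Sl Sr] := bilin_symtens M.
split=> z k x y; rewrite /mulM (Sl, Sr) (linearPl, linearPr) scalerDr;
  by congr pair; rewrite /= !scalerA mulrC.
Qed.

(* What [(xy)z - x(yz)] must gain from the products of [M] with [tensor M]. *)
Definition defect (x y z : M) : W :=
  (atri M x y z, 0) + mulM x (2^-1 *: abrk M y z) - mulM (2^-1 *: abrk M x y) z.

Lemma trilin_defect : trilin defect.
Proof.
have [ml mr] := bilin_mulM; have [Al Am Ar] := atri_trilinear M.
apply: trilinD; first apply: trilinD.
- by split=> z t k x y; rewrite (Al, Am, Ar); congr pair; rewrite /= scaler0 addr0.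
- split=> z t k x y; first by rewrite ml.
    by rewrite linearPl -mr; congr mulM; rewrite scalerDr !scalerA mulrC.
  by rewrite linearPr -mr; congr mulM; rewrite scalerDr !scalerA mulrC.
apply: trilinN; split=> z t k x y.
- by rewrite linearPl -ml; congr mulM; rewrite scalerDr !scalerA mulrC.
- by rewrite linearPr -ml; congr mulM; rewrite scalerDr !scalerA mulrC.
by rewrite mr.
Qed.

(* [rmulT] and [lmulT] are [2 (1 - t)/3] and [- (3 - s + s t)/3] applied to
   [defect]; evaluating them on supersymmetrised tensors applies the remaining
   factors [(1 + s)/2] and [(1 + t)/2]. *)
Definition rmulT (z x y : M) : W :=
  (2 / 3) *: (defect x y z
    - twist (fun _ b c => b && c) (fun x y z => defect x z y) x y z).

Definition lmulT (x y z : M) : W :=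
  - (3^-1 *: (3 *: defect x y z
    - twist (fun a b _ => a && b) (fun x y z => defect y x z) x y z
    + twist (fun a b c => a && (b (+) c)) (fun x y z => defect y z x) x y z)).

Lemma trilin_rmulT : trilin (fun x y z => rmulT z x y).
Proof.
apply: trilinZ; apply: trilinD; first exact: trilin_defect.
by apply: trilinN; apply: trilin_twist; apply/trilin_swap23/trilin_defect.
Qed.

Lemma trilin_lmulT : trilin lmulT.
Proof.
apply: trilinN; apply: trilinZ; apply: trilinD; first apply: trilinD.
- by apply: trilinZ; apply: trilin_defect.
- by apply: trilinN; apply: trilin_twist; apply/trilin_swap12/trilin_defect.
by apply: trilin_twist; apply/trilin_rot/trilin_defect.
Qed.

Lemma bilin_rmulT z : bilin (rmulT z).
Proof. exact: trilin_bilin12 trilin_rmulT. Qed.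

Lemma bilin_lmulT x : bilin (lmulT x).
Proof. exact: trilin_bilin23 trilin_lmulT. Qed.

Definition mulTM (p : tensor M) (z : M) : W := lift (rmulT z) p.
Definition mulMT (x : M) (p : tensor M) : W := lift (lmulT x) p.

Lemma mulTM_linearl z : linear (mulTM^~ z).
Proof. exact: lift_linear (bilin_rmulT z). Qed.

Lemma mulTM_linearr p : linear (mulTM p).
Proof.
move=> k u v; have [_ _ r3] := trilin_rmulT.
by apply: lift_lin => [||| x y]; [exact: bilin_rmulT.. | exact: r3].
Qed.

Lemma mulMT_linearl p : linear (mulMT^~ p).
Proof.
move=> k u v; have [l1 _ _] := trilin_lmulT.
by apply: lift_lin => [||| x y]; [exact: bilin_lmulT.. | exact: l1].
Qed.

Lemma mulMT_linearr x : linear (mulMT x).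
Proof. exact: lift_linear (bilin_lmulT x). Qed.

(** Products of two tensors are set to 0: they occur in no commutator or associator of elements of
    [M]. *)
Definition emul (u v : W) : W := mulM u.1 v.1 + mulTM u.2 v.1 + mulMT u.1 v.2.

Lemma bilin_emul : bilin emul.
Proof.
have [ml mr] := bilin_mulM.
split=> [[w1 w2] k [u1 u2] [v1 v2]|[w1 w2] k [u1 u2] [v1 v2]]; rewrite /emul /=.
  rewrite ml mulTM_linearl mulMT_linearl.
  by rewrite !scalerDr [RHS]addrACA [in RHS](addrACA (k *: _)).
rewrite mr mulTM_linearr mulMT_linearr.
by rewrite !scalerDr [RHS]addrACA [in RHS](addrACA (k *: _)).
Qed.

Definition emb (x : M) : W := (x, 0).

Lemma mulTM0 z : mulTM 0 z = 0.
Proof. exact: linear_fun0 (mulTM_linearl z). Qed.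

Lemma mulMT0 x : mulMT x 0 = 0.
Proof. exact: linear_fun0 (mulMT_linearr x). Qed.

Lemma emul_emb x y : emul (emb x) (emb y) = mulM x y.
Proof. by rewrite /emul /= mulTM0 mulMT0 !addr0. Qed.

Hypothesis n2 : 2 != 0 :> K.

(** The supersymmetric tensor parts cancel, and the two halves of the superanticommutative bracket
    add up. *)
Lemma emul_commutator a b x y : x \in hpart M a -> y \in hpart M b ->
  emul (emb x) (emb y) - (-1) ^+ (a && b) *: emul (emb y) (emb x)
  = emb (abrk M x y).
Proof.
move=> hx hy; rewrite !emul_emb /mulM /emb.
rewrite (symtensC hx hy) (abrk_anti hy hx) andbC.
congr pair; rewrite /=.
  by case: (b && a); rewrite ?expr0 ?expr1; by_coefficients [:: abrk M x y]; field.
by case: (b && a); rewrite ?expr0 ?expr1; by_coefficients [:: symtens x y]; ring.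
Qed.

(** In the [M] component each cyclic double bracket occurs four times with coefficient -1/4 up to
    its sign, which leaves the difference of the two sides of the Akivis identity. In the tensor
    component, [symtens] being supersymmetric, each term occurs twice with 1/2 and twice with
    -1/2. *)
Lemma defect_alternating a b c x y z :
  x \in hpart M a -> y \in hpart M b -> z \in hpart M c ->
  defect x y z
  - (-1) ^+ (b && c) *: defect x z y
  - (-1) ^+ (a && b) *: defect y x z
  + (-1) ^+ (a && (b (+) c)) *: defect y z x
  + (-1) ^+ (c && (a (+) b)) *: defect z x y
  - (-1) ^+ ((a && (b (+) c)) (+) (b && c)) *: defect z y x = 0.
Proof.
move=> hx hy hz; rewrite /defect /mulM.
have hxy := abrk_hpart hx hy; have hyz := abrk_hpart hy hz.
have hzx := abrk_hpart hz hx.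
have [Sl Sr] := bilin_symtens M.
have SZl k u v : symtens (k *: u) v = k *: symtens u v := linear_funZ k u (Sl v).
have SZr k u v : symtens u (k *: v) = k *: symtens u v := linear_funZ k v (Sr u).
have := akivis_identity hx hy hz => /eqP; rewrite eq_sym -subr_eq0 => /eqP jacobi.
(* Inner brackets are put in cyclic order, then moved to the left factor, so that only three double
   brackets and three tensors remain. *)
rewrite (abrk_anti hy hx) (abrk_anti hz hy) (abrk_anti hx hz).
rewrite -!scaleNr !(SZl, SZr, linearZl_LR, linearZr_LR) /=.
rewrite (abrk_anti hx hyz) (abrk_anti hy hzx) (abrk_anti hz hxy).
rewrite (symtensC hyz hx) (symtensC hzx hy) (symtensC hxy hz).
congr pair => /=.
  rewrite -{}jacobi.
  move: (atri M x y z) (atri M x z y) (atri M y x z) => A1 A2 A3.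
  move: (atri M y z x) (atri M z x y) (atri M z y x) => A4 A5 A6.
  move: (abrk M (abrk M x y) z) (abrk M (abrk M y z) x) => J1 J2.
  move: (abrk M (abrk M z x) y) => J3.
  case: a b c {hx hy hz hxy hyz hzx} => -[] [] /=; rewrite ?(expr0, expr1);
    by by_coefficients [:: A1; A2; A3; A4; A5; A6; J1; J2; J3]; field; rewrite ?n2.
move: (symtens (abrk M x y) z) (symtens (abrk M y z) x) => S1 S2.
move: (symtens (abrk M z x) y) => S3.
by case: a b c {hx hy hz hxy hyz hzx jacobi} => -[] [] /=; rewrite ?(expr0, expr1);
  by_coefficients [:: S1; S2; S3]; ring.
Qed.

Lemma rmulTE a b c x y z :
  x \in hpart M a -> y \in hpart M b -> z \in hpart M c ->
  rmulT z x y = (2 / 3) *: (defect x y z - (-1) ^+ (b && c) *: defect x z y).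
Proof.
move=> hx hy hz.
by rewrite /rmulT (twistE _ (trilin_swap23 trilin_defect) hx hy hz).
Qed.

Lemma lmulTE a b c x y z :
  x \in hpart M a -> y \in hpart M b -> z \in hpart M c ->
  lmulT x y z = - (3^-1 *: (3 *: defect x y z
    - (-1) ^+ (a && b) *: defect y x z
    + (-1) ^+ (a && (b (+) c)) *: defect y z x)).
Proof.
move=> hx hy hz.
rewrite /lmulT (twistE _ (trilin_swap12 trilin_defect) hx hy hz).
by rewrite (twistE _ (trilin_rot trilin_defect) hx hy hz).
Qed.

Lemma mulTM_sub_mulMT a b c x y z : 3 != 0 :> K ->
  x \in hpart M a -> y \in hpart M b -> z \in hpart M c ->
  mulTM (symtens x y) z - mulMT x (symtens y z) = defect x y z.
Proof.
move=> n3 hx hy hz.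
have linS (U V : lmodType K) (g : U -> V) : linear g -> forall k p q,
    g (2^-1 *: (p + k *: q)) = 2^-1 *: (g p + k *: g q).
  by move=> lg k p q; rewrite linear_funZ // addrC lg addrC.
rewrite (symtensE hx hy) (symtensE hy hz).
rewrite (linS _ _ _ (mulTM_linearl z)) (linS _ _ _ (mulMT_linearr x)).
rewrite /mulTM /mulMT !lift_tens; try exact: bilin_rmulT; try exact: bilin_lmulT.
rewrite (rmulTE hx hy hz) (rmulTE hy hx hz) (lmulTE hx hy hz) (lmulTE hx hz hy).
(* By the group algebra identity the two sides differ by -1/6 times the alternating sum of [defect],
   which is 0. *)
apply/subr0_eq; rewrite -(scaler0 _ (- 6^-1)) -(defect_alternating hx hy hz).
move: (defect x y z) (defect x z y) (defect y x z) => v1 v2 v3.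
move: (defect y z x) (defect z x y) (defect z y x) => v4 v5 v6.
have n6 : 6 != 0 :> K by rewrite -[6]/((2 * 3)%:R) natrM mulf_neq0.
case: a b c {hx hy hz} => -[] [] /=; rewrite ?(expr0, expr1);
  by by_coefficients [:: v1; v2; v3; v4; v5; v6]; field; rewrite ?n2 ?n3 ?n6.
Qed.

(** The [mulM] terms of the two products cancel the correction terms of [defect], leaving [atri]. *)
Lemma emul_associator a b c x y z : 3 != 0 :> K ->
  x \in hpart M a -> y \in hpart M b -> z \in hpart M c ->
  emul (emul (emb x) (emb y)) (emb z) - emul (emb x) (emul (emb y) (emb z))
  = emb (atri M x y z).
Proof.
move=> n3 hx hy hz; rewrite !emul_emb.
rewrite /emul /= mulTM0 mulMT0 !addr0.
rewrite opprD addrACA (mulTM_sub_mulMT n3 hx hy hz) /defect /emb.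
move: (mulM x _) (mulM _ z) => m1 m2.
by by_coefficients [:: m1; m2; (atri M x y z, 0)]; ring.
Qed.

End Extension.

(** * Grading by the group algebra of Z_2 *)

Section Doubling.
Variables (K : fieldType) (V : lmodType K) (mul : V -> V -> V).
Hypothesis mul_bilin : bilin mul.
Notation W := (V * V)%type.

(* The group algebra of Z_2 over [(V, mul)], with the components as coefficients. *)
Definition hcoord (a : bool) (w : W) : V := if a then w.2 else w.1.
Definition dpart (a : bool) : {pred W} := fun w => hcoord (~~ a) w == 0.
Definition hinj (a : bool) (v : V) : W := if a then (0, v) else (v, 0).

Lemma dpartP a w : reflect (exists v, w = hinj a v) (w \in dpart a).
Proof.
apply: (iffP eqP) => [|[v ->]]; last by case: a.
by case: a w => -[u v] /= ->; [exists v | exists u].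
Qed.

Fact dpart_submod a : submod_closed (dpart a).
Proof.
split=> [|k u v]; first by rewrite unfold_in; case: a.
by rewrite !unfold_in; case: a => /= /eqP-> /eqP->; rewrite scaler0 addr0.
Qed.

Fact dpart_sum (w : W) : exists w0 w1,
  [/\ w0 \in dpart false, w1 \in dpart true & w = w0 + w1].
Proof.
exists (hinj false w.1), (hinj true w.2); split; try by apply/dpartP; eexists.
by case: w => u v; congr pair; rewrite /= ?addr0 ?add0r.
Qed.

Fact dpart_cap (w : W) : w \in dpart false -> w \in dpart true -> w = 0.
Proof. by case: w => u v /eqP /= -> /eqP /= ->. Qed.

Definition double_vect : superVectType K := SuperVect dpart_submod dpart_sum dpart_cap.

Definition dmul (u v : double_vect) : double_vect :=
  (mul u.1 v.1 + mul u.2 v.2, mul u.1 v.2 + mul u.2 v.1).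

Fact dmul_bilinear : bilinear_for (GRing.Scale.Law.clone _ _ *:%R _)
  (GRing.Scale.Law.clone _ _ *:%R _) dmul.
Proof.
have [ml mr] := mul_bilin.
split=> w k u v; rewrite /dmul (ml, mr) (ml, mr) (ml, mr) (ml, mr);
  by congr pair; rewrite /= scalerDr addrACA.
Qed.
HB.instance Definition _ := bilinear_isBilinear.Build K double_vect double_vect
  double_vect _ _ dmul dmul_bilinear.

Lemma dmul_hinj a b u v : dmul (hinj a u) (hinj b v) = hinj (a (+) b) (mul u v).
Proof.
have m0 x : mul x 0 = 0 by apply/linear_fun0/mul_bilin.2.
have m0' x : mul 0 x = 0 := linear_fun0 (mul_bilin.1 x).
by case: a b => -[]; congr pair; rewrite /= ?(m0, m0', addr0, add0r).
Qed.

Fact dmul_hpart a b x y : x \in hpart double_vect a -> y \in hpart double_vect b ->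
  dmul x y \in hpart double_vect (a (+) b).
Proof.
move=> /dpartP[u ->] /dpartP[v ->]; rewrite dmul_hinj.
by apply/dpartP; exists (mul u v).
Qed.

Definition double : superAlgType K := SuperAlg dmul_hpart.

End Doubling.

(** * Embedding into the graded double *)

Lemma eq_hpart (K : fieldType) (M : superVectType K) (V : lmodType K)
    (f g : M -> V) : linear f -> linear g ->
  (forall a x, x \in hpart M a -> f x = g x) -> f =1 g.
Proof.
move=> lf lg fg x; rewrite -[x]hcompD -[hcomp false x]scale1r lf lg.
by rewrite !(fg _ _ (hcomp_in _ x)).
Qed.

Section SpecialDoubling.
Variables (K : fieldType) (M : akivisSuperAlgType K) (V : lmodType K).
Variables (mul : V -> V -> V) (mul_bilin : bilin mul) (e : M -> V).
Hypothesis e_linear : linear e.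
Hypothesis e_inj : injective e.
Hypothesis e_commutator : forall a b x y, x \in hpart M a -> y \in hpart M b ->
  mul (e x) (e y) - (-1) ^+ (a && b) *: mul (e y) (e x) = e (abrk M x y).
Hypothesis e_associator : forall a b c x y z,
  x \in hpart M a -> y \in hpart M b -> z \in hpart M c ->
  mul (mul (e x) (e y)) (e z) - mul (e x) (mul (e y) (e z)) = e (atri M x y z).

Notation W := (double mul_bilin).

(** The linear extension of the map sending a homogeneous [x] to [e x] times the group element of
    its degree. *)
Definition dembed (x : M) : akivis_of W := (e (hcomp false x), e (hcomp true x)).

Fact dembed_linear : linear dembed.
Proof. by move=> k x y; rewrite /dembed !linearP !e_linear. Qed.
HB.instance Definition _ :=
  GRing.isLinear.Build K M (akivis_of W) _ dembed dembed_linear.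

Lemma dembedE a x : x \in hpart M a -> dembed x = hinj a (e x).
Proof.
move=> hx; rewrite /dembed !(hcomp_hpart _ hx).
by case: a {hx}; rewrite /= (linear_fun0 e_linear).
Qed.

Lemma dembed_hpart a x : x \in hpart M a -> dembed x \in hpart (akivis_of W) a.
Proof. by move/dembedE->; apply/dpartP; exists (e x). Qed.

Lemma hinj_linear a : linear (@hinj K V a).
Proof. by case: a => k u v; congr pair; rewrite /= scaler0 addr0. Qed.

Lemma smul_hinj a b u v :
  smul W (hinj a u) (hinj b v) = hinj (a (+) b) (mul u v).
Proof. exact: dmul_hinj. Qed.

Lemma dembed_abrk_hpart a b x y : x \in hpart M a -> y \in hpart M b ->
  dembed (abrk M x y) = abrk (akivis_of W) (dembed x) (dembed y).
Proof.
move=> hx hy; rewrite (dembedE (abrk_hpart hx hy)) -(e_commutator hx hy).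
rewrite [RHS](superbracketE (dembed_hpart hx) (dembed_hpart hy)).
rewrite (dembedE hx) (dembedE hy) !smul_hinj.
(* Both products lie over the same group element; the difference is reordered into the shape
   [k *: u + v] required by [hinj_linear]. *)
rewrite [b (+) a]addbC addrC -scaleNr hinj_linear.
by rewrite scaleNr addrC.
Qed.

Lemma dembed_atri_hpart a b c x y z :
  x \in hpart M a -> y \in hpart M b -> z \in hpart M c ->
  dembed (atri M x y z) = atri (akivis_of W) (dembed x) (dembed y) (dembed z).
Proof.
move=> hx hy hz; rewrite (dembedE (atri_hpart hx hy hz)) -(e_associator hx hy hz).
rewrite [RHS]/(associator _ _ _) (dembedE hx) (dembedE hy) (dembedE hz).
rewrite !smul_hinj -addbA.
by rewrite addrC -scaleN1r hinj_linear scaleN1r addrC.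
Qed.

Lemma special_doubling : special M.
Proof.
exists W, dembed; split; last first.
  move=> x y exy; have e0 : hcomp false x = hcomp false y := e_inj (congr1 fst exy).
  have e1 : hcomp true x = hcomp true y := e_inj (congr1 snd exy).
  by rewrite -[x]hcompD e0 e1 hcompD.
split=> [|x y|x y z]; first exact: dembed_hpart.
  (* Both sides are linear in each argument, so the arguments may be taken homogeneous one at a
     time. *)
  apply: (@eq_hpart _ _ _ (fun x => dembed (abrk M x y))
    (fun x => abrk (akivis_of W) (dembed x) (dembed y))) => [k u v|k u v|a u hu].
  - by rewrite linearPl linearP.
  - by rewrite linearP linearPl.
  apply: (@eq_hpart _ _ _ (fun y => dembed (abrk M u y))
    (fun y => abrk (akivis_of W) (dembed u) (dembed y))) => [k v w|k v w|b v hv].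
  - by rewrite linearPr linearP.
  - by rewrite linearP linearPr.
  exact: dembed_abrk_hpart hu hv.
have [A1 A2 A3] := atri_trilinear M.
have [B1 B2 B3] := atri_trilinear (akivis_of W).
pose f u v w := dembed (atri M u v w).
pose g u v w := atri (akivis_of W) (dembed u) (dembed v) (dembed w).
have [f1 f2 f3] : trilin f by split=> v w k u u'; rewrite /f (A1, A2, A3) linearP.
have [g1 g2 g3] : trilin g by split=> v w k u u'; rewrite /g linearP (B1, B2, B3).
apply: (eq_hpart (f1 y z) (g1 y z)) => a u hu.
apply: (eq_hpart (f2 u z) (g2 u z)) => b v hv.
apply: (eq_hpart (f3 u v) (g3 u v)) => c w hw.
exact: dembed_atri_hpart hu hv hw.
Qed.
End SpecialDoubling.

(** * Speciality of Akivis superalgebras *)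

Theorem corollary2 (K : fieldType) (K_not2 : 2%N \notin [pchar K])
    (K_not3 : 3%N \notin [pchar K]) (M : akivisSuperAlgType K) :
  special M.
Proof.
have n2 : 2 != 0 :> K by move: K_not2; rewrite inE.
have n3 : 3 != 0 :> K by move: K_not3; rewrite inE.
apply: (special_doubling (bilin_emul M) (e := @emb K M)).
- by move=> k x y; congr pair; rewrite /= scaler0 addr0.
- by move=> x y [].
- exact: emul_commutator n2.
- by move=> *; apply: (emul_associator n2 n3); eassumption.
Qed.
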